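(* Let $X$ be a noncompact zero-dimensional Hausdorff space. Suppose $\mathcal{P}\in\Omega(X)$ is such that $X$ is $c_{\mathcal{P}}$-compact. Then there exists $\mathcal{R}\in\Omega(X)$ such that $\mathcal{R}\subsetneq\mathcal{P}$ and $X$ is $c_{\mathcal{R}}$-compact.
   Context: A Hausdorff space is zero-dimensional if it has a base of clopen sets. A family $\mathcal{P}$ of closed sets in $X$ is an ideal of closed sets if $A,B\in\mathcal{P}$ and $C$ a closed subset of $A$ imply $A\cup B\in\mathcal{P}$ and $C\in\mathcal{P}$. $\Omega(X)$ is the collection of all ideals of closed sets in $X$. $C(X)$ is the ring of real-valued continuous functions on $X$; for $f\in C(X)$, $Z(f)=\{x\in X: f(x)=0\}$. For $\mathcal{P}\in\Omega(X)$, $C_{\mathcal{P}}(X)=\{f\in C(X): \mathrm{cl}_X(X\setminus Z(f))\in\mathcal{P}\}$. $C(X,\mathbb{Z})$ is the set of continuous functions $X\to\mathbb{Z}$, where $\mathbb{Z}$ has the discrete topology. A family $\mathcal{F}$ of subsets of $X$ is $c_{\mathcal{P}}$-stable if for every $f\in C(X,\mathbb{Z})\cap C_{\mathcal{P}}(X)$ there exists $F\in\mathcal{F}$ such that $f$ is bounded on $F$. $X$ is $c_{\mathcal{P}}$-compact if every $c_{\mathcal{P}}$-stable family of closed sets in $X$ with the finite intersection property has nonempty intersection. *)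

(* Defs.v *)
From HB Require Import structures.
From mathcomp Require Import all_boot all_order all_algebra.
From mathcomp Require Import all_classical all_reals all_analysis.
Import Order.TTheory GRing.Theory Num.Theory.
Import numFieldNormedType.Exports.

Set Implicit Arguments.
Unset Strict Implicit.
Unset Printing Implicit Defensive.

Local Open Scope classical_set_scope.
Local Open Scope ring_scope.

(* The library's [zero_dimensional] only says that clopen sets separate points,
   which is weaker than having a base of clopen sets. *)
Definition has_clopen_base (X : topologicalType) : Prop :=
  exists2 B : set (set X), B `<=` clopen & basis B.

(* The collection Omega(X). *)
Definition closed_ideal (X : topologicalType) : set (set (set X)) :=
  [set P | [/\ P `<=` closed,
               (forall A B, P A -> P B -> P (A `|` B))
             & (forall A C, P A -> closed C -> C `<=` A -> P C)]].

Arguments closed_ideal : clear implicits.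

Definition zero_set (R : realType) (X : topologicalType) (f : X -> R) : set X :=
  [set x | f x = 0].

Definition C_ideal (R : realType) (X : topologicalType) (P : set (set X)) :
    set (X -> R) :=
  [set f | continuous f /\ P (closure (~` zero_set f))].

Arguments C_ideal R {X} P.

(* C(X, Z), viewed inside the real-valued functions. *)
Definition C_int (R : realType) (X : topologicalType) : set (X -> R) :=
  [set f | exists2 g : X -> discrete_topology int,
             continuous g & f = (fun x => (g x : int)%:~R)].

Arguments C_int : clear implicits.

Definition c_stable (R : realType) (X : topologicalType) (P : set (set X))
    (F : set (set X)) : Prop :=
  forall f : X -> R, (C_int R X `&` C_ideal R P) f ->
    exists2 A, F A & [bounded f x | x in A].

Arguments c_stable R {X} P F.

Definition c_compact (R : realType) (X : topologicalType) (P : set (set X)) :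
    Prop :=
  forall F : set (set X), F `<=` closed -> c_stable R P F -> finI F id ->
    \bigcap_(A in F) A !=set0.

Arguments c_compact R {X} P.

(* Main.v *)
Require Import Defs.
From HB Require Import structures.
From mathcomp Require Import all_boot all_order all_algebra.
From mathcomp Require Import all_classical all_reals all_analysis.

Import Num.Theory.
Import numFieldNormedType.Exports.

Local Open Scope classical_set_scope.

(** An integer-valued continuous function is constant on a clopen neighbourhood
    of any point [p], and resetting it to [0] there affects neither its
    unboundedness on a set nor the membership of its support in [P].  Hence the
    members of [P] that avoid [p] form an ideal whose stable families are also
    [P]-stable; it is smaller than [P] as soon as [p] lies in a member of [P].
    Such a [p] exists: if the only possible member of [P] is the empty set,
    every nonempty family is [P]-stable and c_P-compactness is compactness. *)

(** Since [g] is locally constant, so is its composite with any [h]. *)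
Lemma continuous_discrete_comp {X : topologicalType} {T : choiceType}
    {Y : topologicalType} (g : X -> discrete_topology T) (h : T -> Y) :
  continuous g -> continuous (fun x => h (g x)).
Proof.
move=> cg x; have gx : \forall y \near x, g y = g x.
  exact: (cg x [set g x] (discrete_set1 _)).
by move=> U /nbhs_singleton Uhx; apply: filterS gx => y /= ->.
Qed.

Definition avoiding {X : Type} (P : set (set X)) (p : X) : set (set X) :=
  [set A | P A /\ ~ A p].

Lemma closed_ideal_avoiding {X : topologicalType} (P : set (set X)) (p : X) :
  closed_ideal X P -> closed_ideal X (avoiding P p).
Proof.
move=> [Pc PU PS]; split=> [A [/Pc]//|A B [PA Ap] [PB Bp]|A C [PA Ap] cC CA].
- by split; [exact: PU|case].
- by split; [exact: (PS A)|move/CA].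
Qed.

Lemma c_stable_avoiding {R : realType} {X : topologicalType}
    (P : set (set X)) (p : X) (F : set (set X)) :
  closed_ideal X P -> c_stable R (avoiding P p) F -> c_stable R P F.
Proof.
move=> [_ _ PS] stF f [[g cg fE] [_ Pf]].
pose h (n : int) : int := if n == g p then 0%R else n.
have ch : continuous (fun x => h (g x) : discrete_topology int).
  exact: (continuous_discrete_comp _ (h : int -> discrete_topology int)).
pose f' (x : X) : R := ((h (g x))%:~R)%R.
have f'f : closure (~` zero_set f') `<=` closure (~` zero_set f).
  apply: closureS => x f'x fx; apply: f'x; move: fx.
  by rewrite /zero_set /= fE /f' /h; case: ifP.
have [A FA bA] : exists2 A, F A & [bounded f' x | x in A].
  apply: stF; split; first by exists (fun x => h (g x)).
  split; first exact: (continuous_discrete_comp _ (fun n => (h n)%:~R%R : R)).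
  split; first by apply: PS Pf _ f'f; exact: closed_closure.
  (* The fibre of [g] through [p] is an open neighbourhood of [p] on which [f'] vanishes, so [p] is
     outside the closed support of [f']. *)
  move=> /(_ [set x | g x = g p]) [|x [f'x gx]].
    exact: (cg p [set g p] (discrete_set1 _)).
  by apply: f'x; rewrite /zero_set /= /f' /h gx eqxx.
exists A => //.
(* Wherever [f] and [f'] differ, [f] takes the value [f p]; a bound for [f'] that is at least
   [|f p|] thus bounds [f]. *)
have : \forall M \near +oo%R, (`|f p| <= M)%R by exact: nbhs_pinfty_ge.
move: bA; rewrite /bounded_near; apply: filterS2 => M bM pM x Ax /=.
have := bM _ Ax; rewrite /= /f' /h; case: eqP => [gx _|_].
- by move: pM; rewrite fE gx.
- by rewrite fE.
Qed.

Lemma c_compact_trivial {R : realType} {X : topologicalType}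
    (P : set (set X)) :
  P `<=` [set set0] -> c_compact R P -> compact [set: X].
Proof.
move=> P0 cP F FF _; rewrite setTI clusterE.
(* A point common to all closed members of the proper filter [F] is a cluster point, as closures of
   members are members. *)
have [x Fx] : \bigcap_(A in [set A | closed A /\ F A]) A !=set0.
  apply: cP => [A []//|f [_ [_ /P0 f0]]|D DF].
  (* The support of [f] is empty, so [f] is zero and bounded on all of [X]. *)
  - exists setT; first by split; [exact: closedT|exact: filterT].
    have fE x : f x = 0%R.
      apply: contrapT => fx.
      by have /= : closure (~` zero_set f) x by [exact: subset_closure];
        rewrite f0.
    rewrite /bounded_near.
    apply: filterS (nbhs_pinfty_ge (num_real (0 : R)%R)) => M M0 x _ /=.
    by rewrite fE normr0.
  - apply: (@filter_ex _ F); apply: filter_bigI => A AD.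
    by have := DF _ AD; rewrite inE => -[].
by exists x => A FA; apply: Fx; split;
  [exact: closed_closure|apply: filterS FA; exact: subset_closure].
Qed.

Theorem theorem3p3 (R : realType) (X : topologicalType)
    (hX : hausdorff_space X) (zX : has_clopen_base X)
    (ncX : ~ compact [set: X])
    (P : set (set X)) (hP : closed_ideal X P) (cP : c_compact R P) :
  exists Q : set (set X), [/\ closed_ideal X Q, Q `<` P & c_compact R Q].
Proof.
have [A PA [p Ap]] : exists2 A, P A & A !=set0.
  apply: contrapT => noA; apply: ncX; apply: c_compact_trivial cP => A PA /=.
  by apply: contrapT => /eqP/set0P A0; apply: noA; exists A.
exists (avoiding P p); split; first exact: closed_ideal_avoiding.
(* The inclusion is strict because [A] is in [P] and contains [p]. *)
- by split=> [B []//|/(_ _ PA)[_ /(_ Ap)]].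
- by move=> F Fc /(c_stable_avoiding _ _ _ hP) stF; exact: cP.
Qed.
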